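(* (Derivability of the translated interaction axioms of (I)EAK.) For every atomic proposition $p$, every functional action $\alpha$ of type $\mathsf{Fnc}$, every agent $\mathtt a$ of type $\mathsf{Ag}$ and all operational terms $A,B$ of type $\mathsf{Fm}$, the following sequents are derivable in the Dynamic Calculus defined in the context (without the Grishin rules), where $C\dashv\vdash D$ means that both $C\vdash D$ and $D\vdash C$ are derivable: 1. $\alpha\vartriangle_0 p\dashv\vdash(\alpha\vartriangle_0\top)\wedge p$; 2. $\alpha\vartriangleright_0 p\dashv\vdash(\alpha\vartriangle_0\top)\to p$; 3. $\alpha\vartriangle_0\bot\dashv\vdash\bot$; 4. $\alpha\vartriangle_0\top\dashv\vdash\alpha\vartriangle_0\top$; 5. $\alpha\vartriangleright_0\top\dashv\vdash\top$; 6. $\alpha\vartriangleright_0\bot\dashv\vdash(\alpha\vartriangle_0\top)\to\bot$; 7. $\alpha\vartriangleright_0(A\wedge B)\dashv\vdash(\alpha\vartriangleright_0A)\wedge(\alpha\vartriangleright_0B)$; 8. $\alpha\vartriangle_0(A\wedge B)\dashv\vdash(\alpha\vartriangle_0A)\wedge(\alpha\vartriangle_0B)$; 9. $\alpha\vartriangle_0(A\vee B)\dashv\vdash(\alpha\vartriangle_0A)\vee(\alpha\vartriangle_0B)$; 10. $\alpha\vartriangleright_0(A\vee B)\dashv\vdash(\alpha\vartriangle_0\top)\to((\alpha\vartriangle_0A)\vee(\alpha\vartriangle_0B))$; 11. $\alpha\vartriangle_0(A\to B)\dashv\vdash(\alpha\vartriangle_0\top)\wedge((\alpha\vartriangle_0A)\to(\alpha\vartriangle_0B))$;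 12. $\alpha\vartriangleright_0(A\to B)\dashv\vdash(\alpha\vartriangle_0A)\to(\alpha\vartriangle_0B)$; 13. $\alpha\vartriangle_0(\mathtt a\vartriangle_2A)\dashv\vdash(\alpha\vartriangle_0\top)\wedge(\mathtt a\vartriangle_2((\mathtt a\blacktriangle_3\alpha)\vartriangle_1A))$; 14. $\alpha\vartriangleright_0(\mathtt a\vartriangle_2A)\dashv\vdash(\alpha\vartriangle_0\top)\to(\mathtt a\vartriangle_2((\mathtt a\blacktriangle_3\alpha)\vartriangle_1A))$; 15. $\alpha\vartriangleright_0(\mathtt a\vartriangleright_2A)\dashv\vdash(\alpha\vartriangle_0\top)\to(\mathtt a\vartriangleright_2((\mathtt a\blacktriangle_3\alpha)\vartriangleright_1A))$; 16. $\alpha\vartriangle_0(\mathtt a\vartriangleright_2A)\dashv\vdash(\alpha\vartriangle_0\top)\wedge(\mathtt a\vartriangleright_2((\mathtt a\blacktriangle_3\alpha)\vartriangleright_1A))$.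
   Context: These sequents are the translations of the interaction axioms of the intuitionistic logic of epistemic actions and knowledge, under $\langle\alpha\rangle A\mapsto\alpha\vartriangle_0A$, $[\alpha]A\mapsto\alpha\vartriangleright_0A$, $\langle\mathtt a\rangle A\mapsto\mathtt a\vartriangle_2A$, $[\mathtt a]A\mapsto\mathtt a\vartriangleright_2A$, $Pre(\alpha)\mapsto\alpha\vartriangle_0\top$, $\bigvee\{\langle\mathtt a\rangle\langle\beta\rangle A\mid\alpha\mathtt a\beta\}\mapsto\mathtt a\vartriangle_2((\mathtt a\blacktriangle_3\alpha)\vartriangle_1A)$ and $\bigwedge\{[\mathtt a][\beta]A\mid\alpha\mathtt a\beta\}\mapsto\mathtt a\vartriangleright_2((\mathtt a\blacktriangle_3\alpha)\vartriangleright_1A)$. **The Dynamic Calculus.** Notation: an inference is written ''premises / conclusion''; ''//'' marks a rule applicable in both directions. Hatted symbols are structural connectives, unhatted ones operational connectives, and symbols with a tilde are structural connectives called virtual adjoints. *Operational terms.* There are four pairwise disjoint types $\mathsf{Fm},\mathsf{Fnc},\mathsf{Act},\mathsf{Ag}$. Given sets of atomic propositions $p$, of atomic functional actions $\alpha$ and of atomic agents $\mathtt a$: the terms of type $\mathsf{Fnc}$ are the atoms $\alpha$; the terms of type $\mathsf{Ag}$ are the atoms $\mathtt a$; the terms of type $\mathsf{Act}$ are $\gamma ::= \mathtt a\blacktriangle_3\alpha\mid \mathtt a\vartriangle_3\alpha$; the terms of type $\mathsf{Fm}$ are $A::= p\mid\bot\mid\top\mid A\wedge A\mid A\vee A\mid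 A\to A\mid A\leftarrow A\mid A\succ A\mid A\prec A\mid \alpha\,\sharp_0 A\mid\gamma\,\sharp_1 A\mid\mathtt a\,\sharp_2 A$, where $\sharp\in\{\vartriangle,\blacktriangle,\vartriangleright,\blacktriangleright\}$. *Structures.* The types $\mathsf{FM}\ni X$, $\mathsf{FNC}\ni F$, $\mathsf{ACT}\ni\Gamma$, $\mathsf{AG}\ni\mathbf a$ are defined by simultaneous recursion: $X::=A\mid \mathrm I\mid X;X\mid X>X\mid X<X\mid F\,\hat\sharp_0 X\mid\Gamma\,\hat\sharp_1X\mid\mathbf a\,\hat\sharp_2X$ with $\hat\sharp\in\{\hat\vartriangle,\hat\blacktriangle,\hat\vartriangleright,\hat\blacktriangleright\}$; $F::=\alpha\mid X\tilde\vartriangleleft_0X\mid X\tilde\blacktriangleleft_0X\mid\mathbf a\,\tilde\vartriangleright_3\Gamma\mid\mathbf a\,\tilde\blacktriangleright_3\Gamma$; $\Gamma::=\gamma\mid\mathbf a\,\hat\blacktriangle_3F\mid\mathbf a\,\hat\vartriangle_3F\mid X\hat\vartriangleleft_1X\mid X\hat\blacktriangleleft_1X$; $\mathbf a::=\mathtt a\mid X\tilde\vartriangleleft_2X\mid X\tilde\blacktriangleleft_2X\mid\Gamma\tilde\vartriangleleft_3F\mid\Gamma\tilde\blacktriangleleft_3F$. Sequents have the form $x\vdash y$ with $x,y$ structures. Below $X,Y,Z,W$ are of type $\mathsf{FM}$; $A,B$ of type $\mathsf{Fm}$; $x,y,z$ are structures and $a,b$ operational terms of the type making the expression well formed. *Axioms.*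 $\mathtt a\vdash\mathtt a$; $\alpha\vdash\alpha$; $\bot\vdash\mathrm I$; $\mathrm I\vdash\top$; and *atom*: $F_1\circ_1(F_2\circ_2\cdots(F_n\circ_n p)\cdots)\vdash G_1\rhd_1(G_2\rhd_2\cdots(G_m\rhd_m p)\cdots)$ for $n,m\ge0$, $F_i,G_j\in\mathsf{FNC}$, $\circ_i\in\{\hat\vartriangle_0,\hat\blacktriangle_0\}$, $\rhd_j\in\{\hat\vartriangleright_0,\hat\blacktriangleright_0\}$ (in particular $p\vdash p$). *Cut rules* (one per type): $x\vdash a,\ a\vdash y\ /\ x\vdash y$, with $x,a,y$ all of the same type (agents, functional actions, actions, or formulas). *Propositional structural rules.* $X\vdash Y\ //\ \mathrm I\vdash Y<X$; $X\vdash Y\ //\ X<Y\vdash\mathrm I$; $X\vdash Y\ //\ \mathrm I\vdash X>Y$; $X\vdash Y\ //\ Y>X\vdash\mathrm I$; $\mathrm I\vdash X\ /\ Y\vdash X$; $X\vdash\mathrm I\ /\ X\vdash Y$; $X\vdash Z\ /\ Y\vdash Z<X$; $X\vdash Z\ /\ X<Z\vdash Y$; $X\vdash Z\ /\ Y\vdash X>Z$; $X\vdash Z\ /\ Z>X\vdash Y$; $X;X\vdash Y\ /\ X\vdash Y$; $Y\vdash X;X\ /\ Y\vdash X$; $Y;X\vdash Z\ /\ X;Y\vdash Z$; $Z\vdash X;Y\ /\ Z\vdash Y;X$; $X;(Y;Z)\vdash W\ /\ (X;Y);Z\vdash W$; $W\vdash(Z;Y);X\ /\ W\vdash Z;(Y;X)$.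 Display postulates: $X;Y\vdash Z\ //\ X\vdash Z<Y$; $Z\vdash X;Y\ //\ Z<Y\vdash X$; $X;Y\vdash Z\ //\ Y\vdash X>Z$; $Z\vdash X;Y\ //\ X>Z\vdash Y$. (The Grishin rules $X>(Y;Z)\vdash W\ //\ (X>Y);Z\vdash W$ and $W\vdash X>(Y;Z)\ //\ W\vdash(X>Y);Z$ give the classical base and are not included here.) *Propositional operational rules.* $X\vdash\mathrm I\ /\ X\vdash\bot$; $\mathrm I\vdash X\ /\ \top\vdash X$; $A;B\vdash Z\ /\ A\wedge B\vdash Z$; $X\vdash A,\ Y\vdash B\ /\ X;Y\vdash A\wedge B$; $A\vdash X,\ B\vdash Y\ /\ A\vee B\vdash X;Y$; $Z\vdash A;B\ /\ Z\vdash A\vee B$; $B\vdash Y,\ X\vdash A\ /\ B\leftarrow A\vdash Y<X$; $Z\vdash B<A\ /\ Z\vdash B\leftarrow A$; $B<A\vdash Z\ /\ B\prec A\vdash Z$; $Y\vdash B,\ A\vdash X\ /\ Y<X\vdash B\prec A$; $X\vdash A,\ B\vdash Y\ /\ A\to B\vdash X>Y$; $Z\vdash A>B\ /\ Z\vdash A\to B$; $A>B\vdash Z\ /\ A\succ B\vdash Z$; $A\vdash X,\ Y\vdash B\ /\ X>Y\vdash A\succ B$. *Heterogeneous operational rules.* For $0\le i\le3$ and $\sharp\in\{\vartriangle,\blacktriangle\}$: $a\,\hat\sharp_i\,b\vdash z\ /\ a\,\sharp_i\,b\vdash z$; $x\vdash a,\ y\vdash b\ /\ x\,\hat\sharp_i\,y\vdash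 a\,\sharp_i\,b$. For $0\le i\le2$ and $\sharp\in\{\vartriangleright,\blacktriangleright\}$: $x\vdash a,\ B\vdash Y\ /\ a\,\sharp_iB\vdash x\,\hat\sharp_iY$; $Z\vdash a\,\hat\sharp_iB\ /\ Z\vdash a\,\sharp_iB$. *Heterogeneous display postulates.* For $0\le i\le2$: $x\hat\vartriangle_iy\vdash z\ //\ y\vdash x\hat\blacktriangleright_iz$; $x\hat\blacktriangle_iy\vdash z\ //\ y\vdash x\hat\vartriangleright_iz$. For $i=1$: $x\hat\vartriangle_1y\vdash z\ //\ x\vdash z\hat\blacktriangleleft_1y$; $x\hat\blacktriangle_1y\vdash z\ //\ x\vdash z\hat\vartriangleleft_1y$. For $i\in\{0,2,3\}$: $x\hat\vartriangle_iy\vdash z\ //\ x\vdash z\tilde\blacktriangleleft_iy$; $x\hat\blacktriangle_iy\vdash z\ //\ x\vdash z\tilde\vartriangleleft_iy$. For $i=3$: $x\hat\vartriangle_3y\vdash z\ //\ y\vdash x\tilde\blacktriangleright_3z$; $x\hat\blacktriangle_3y\vdash z\ //\ y\vdash x\tilde\vartriangleright_3z$. *Necessitation, conjugation, Fischer Servi, monotonicity*, for $0\le i\le2$: $\mathrm I\vdash W\ /\ x\hat\vartriangle_i\mathrm I\vdash W$; $\mathrm I\vdash W\ /\ x\hat\blacktriangle_i\mathrm I\vdash W$; $W\vdash\mathrm I\ /\ W\vdash x\hat\vartriangleright_i\mathrm I$; $W\vdash\mathrm I\ /\ W\vdash x\hat\blacktriangleright_i\mathrm I$; $x\hat\vartriangle_i((x\hat\blacktriangle_iY);Z)\vdash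 W\ /\ Y;(x\hat\vartriangle_iZ)\vdash W$; $x\hat\blacktriangle_i((x\hat\vartriangle_iY);Z)\vdash W\ /\ Y;(x\hat\blacktriangle_iZ)\vdash W$; $W\vdash x\hat\vartriangleright_i((x\hat\blacktriangleright_iY);Z)\ /\ W\vdash Y;(x\hat\vartriangleright_iZ)$; $W\vdash x\hat\blacktriangleright_i((x\hat\vartriangleright_iY);Z)\ /\ W\vdash Y;(x\hat\blacktriangleright_iZ)$; $(x\hat\vartriangleright_iY)>(x\hat\vartriangle_iZ)\vdash W\ /\ x\hat\vartriangle_i(Y>Z)\vdash W$; $(x\hat\blacktriangleright_iY)>(x\hat\blacktriangle_iZ)\vdash W\ /\ x\hat\blacktriangle_i(Y>Z)\vdash W$; $W\vdash(x\hat\vartriangle_iY)>(x\hat\vartriangleright_iZ)\ /\ W\vdash x\hat\vartriangleright_i(Y>Z)$; $W\vdash(x\hat\blacktriangle_iY)>(x\hat\blacktriangleright_iZ)\ /\ W\vdash x\hat\blacktriangleright_i(Y>Z)$; $(x\hat\vartriangle_iY);(x\hat\vartriangle_iZ)\vdash W\ /\ x\hat\vartriangle_i(Y;Z)\vdash W$; $(x\hat\blacktriangle_iY);(x\hat\blacktriangle_iZ)\vdash W\ /\ x\hat\blacktriangle_i(Y;Z)\vdash W$; $W\vdash(x\hat\vartriangleright_iY);(x\hat\vartriangleright_iZ)\ /\ W\vdash x\hat\vartriangleright_i(Y;Z)$; $W\vdash(x\hat\blacktriangleright_iY);(x\hat\blacktriangleright_iZ)\ /\ W\vdash x\hat\blacktriangleright_i(Y;Z)$.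 *Interaction rules.* swap-out: $(\mathbf a\hat\blacktriangle_3F)\hat\blacktriangle_1(\mathbf a\hat\blacktriangle_2X)\vdash Y\ /\ \mathbf a\hat\blacktriangle_2(F\hat\blacktriangle_0X)\vdash Y$; $X\vdash(\mathbf a\hat\blacktriangle_3F)\hat\blacktriangleright_1(\mathbf a\hat\blacktriangleright_2Y)\ /\ X\vdash\mathbf a\hat\blacktriangleright_2(F\hat\blacktriangleright_0Y)$. swap-in: $\mathbf a\hat\blacktriangle_2(F\hat\blacktriangle_0X)\vdash Y\ /\ (\mathbf a\hat\blacktriangle_3F)\hat\blacktriangle_1(\mathbf a\hat\blacktriangle_2((F\hat\vartriangle_0\mathrm I);X))\vdash Y$; $X\vdash\mathbf a\hat\blacktriangleright_2(F\hat\blacktriangleright_0Y)\ /\ X\vdash(\mathbf a\hat\blacktriangle_3F)\hat\blacktriangleright_1(\mathbf a\hat\blacktriangleright_2((F\hat\vartriangle_0\mathrm I)>Y))$. balance: $X\vdash Y\ /\ F\hat\vartriangle_0X\vdash F\hat\vartriangleright_0Y$, for $F\in\mathsf{FNC}$. *)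

(* Defs.v *)
Set Implicit Arguments.
Unset Strict Implicit.

From Stdlib Require Import List.

Record signature := Signature {
  prop_atom : Type;
  fnc_atom : Type;
  ag_atom : Type }.

Inductive typ := Fm | Fnc | Act | Ag.

(* The subscripts of the heterogeneous connectives: [idx] is {0,1,2,3} and
   [idx2] is {0,1,2}. *)
Inductive idx2 := k0 | k1 | k2.
Inductive idx := low (k : idx2) | k3.
Coercion low : idx2 >-> idx.

(* The white and the black triangle with subscript [i] both have the
   functional type [fst_typ i] x [snd_typ i] -> [tgt_typ i]. *)
Definition fst_typ (i : idx) : typ :=
  match i with
  | low k0 => Fnc
  | low k1 => Act
  | low k2 => Ag
  | k3 => Ag
  end.

Definition snd_typ (i : idx) : typ :=
  match i with low _ => Fm | k3 => Fnc end.

Definition tgt_typ (i : idx) : typ :=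
  match i with low _ => Fm | k3 => Act end.

(* The colour of a triangle: white (▵, ▹, ◃) or black (▴, ▸, ◂). *)
Inductive colour := white | black.

Definition opp (c : colour) : colour :=
  match c with white => black | black => white end.

(* Operational terms.  Those of type [Fnc] and [Ag] are just the atoms; those
   of type [Act] are [odia c k3 a alpha]. *)
Inductive term (S : signature) : typ -> Type :=
| Prp : prop_atom S -> term S Fm
| FncAtom : fnc_atom S -> term S Fnc
| AgAtom : ag_atom S -> term S Ag
| Bot : term S Fm
| Top : term S Fm
| And : term S Fm -> term S Fm -> term S Fm
| Or : term S Fm -> term S Fm -> term S Fm
| Imp : term S Fm -> term S Fm -> term S Fm        (* A → B *)
| LImp : term S Fm -> term S Fm -> term S Fm       (* A ← B *)
| CoImp : term S Fm -> term S Fm -> term S Fm      (* A ≻ B *)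
| LCoImp : term S Fm -> term S Fm -> term S Fm     (* A ≺ B *)
| odia (c : colour) (i : idx) :                    (* ▵ and ▴ *)
    term S (fst_typ i) -> term S (snd_typ i) -> term S (tgt_typ i)
| obox (c : colour) (k : idx2) :                   (* ▹ and ▸ *)
    term S (fst_typ k) -> term S Fm -> term S Fm.

Arguments Bot {S}.
Arguments Top {S}.
Arguments odia {S} c i _ _.
Arguments obox {S} c k _ _.

(* Structures.  The structural triangles are hatted, except [sbox] at [k3]
   and [slft] at [k0], [k2], [k3], which are the virtual adjoints (tilde). *)
Inductive structure (S : signature) : typ -> Type :=
| emb (t : typ) : term S t -> structure S t
| sI : structure S Fm
| comma : structure S Fm -> structure S Fm -> structure S Fm   (* X ; Y *)
| gtr : structure S Fm -> structure S Fm -> structure S Fm     (* X > Y *)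
| lss : structure S Fm -> structure S Fm -> structure S Fm     (* X < Y *)
| sdia (c : colour) (i : idx) :                                (* ▵ and ▴ *)
    structure S (fst_typ i) -> structure S (snd_typ i) ->
    structure S (tgt_typ i)
| sbox (c : colour) (i : idx) :                                (* ▹ and ▸ *)
    structure S (fst_typ i) -> structure S (tgt_typ i) ->
    structure S (snd_typ i)
| slft (c : colour) (i : idx) :                                (* ◃ and ◂ *)
    structure S (tgt_typ i) -> structure S (snd_typ i) ->
    structure S (fst_typ i).

Coercion emb : term >-> structure.
Arguments sI {S}.
Arguments sdia {S} c i _ _.
Arguments sbox {S} c i _ _.
Arguments slft {S} c i _ _.

(* Both sides of a sequent have the same type. *)
Inductive sequent (S : signature) :=
  Seq (t : typ) (x y : structure S t).

Declare Scope dc_scope.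
Delimit Scope dc_scope with dc.
Bind Scope dc_scope with term structure sequent.

Notation "a ▵[ i ] b" := (odia white i a b)
  (at level 35, right associativity, format "a  ▵[ i ]  b") : dc_scope.
Notation "a ▴[ i ] b" := (odia black i a b)
  (at level 35, right associativity, format "a  ▴[ i ]  b") : dc_scope.
Notation "a ▹[ i ] b" := (obox white i a b)
  (at level 35, right associativity, format "a  ▹[ i ]  b") : dc_scope.
Notation "A ⋏ B" := (And A B) (at level 45, right associativity) : dc_scope.
Notation "A ⋎ B" := (Or A B) (at level 45, right associativity) : dc_scope.
Notation "A ⟶ B" := (Imp A B) (at level 47, right associativity) : dc_scope.
Notation "X ⨾ Y" := (comma X Y) (at level 55, no associativity) : dc_scope.
Notation "X ⋗ Y" := (gtr X Y) (at level 55, no associativity) : dc_scope.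
Notation "X ⋖ Y" := (lss X Y) (at level 55, no associativity) : dc_scope.
Notation "x ⊢ y" := (Seq x y) (at level 65, no associativity) : dc_scope.

Local Open Scope dc_scope.

(* [pre d [(c1, F1); ...; (cn, Fn)] X] is [d c1 F1 (... (d cn Fn X))]; with
   [d] a hatted triangle of subscript 0 these are the two sides of the atom
   axiom. *)
Definition pre (S : signature)
    (d : colour -> structure S Fnc -> structure S Fm -> structure S Fm)
    (l : list (colour * structure S Fnc)) (X : structure S Fm) :
    structure S Fm :=
  fold_right (fun cF Y => d (fst cF) (snd cF) Y) X l.

(* The rules that may be applied in both directions. *)
Inductive birule (S : signature) : sequent S -> sequent S -> Prop :=
| bi_I_lss X Y : birule (X ⊢ Y) (sI ⊢ Y ⋖ X)
| bi_lss_I X Y : birule (X ⊢ Y) (X ⋖ Y ⊢ sI)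
| bi_I_gtr X Y : birule (X ⊢ Y) (sI ⊢ X ⋗ Y)
| bi_gtr_I X Y : birule (X ⊢ Y) (Y ⋗ X ⊢ sI)
| bi_comma_lss X Y Z : birule (X ⨾ Y ⊢ Z) (X ⊢ Z ⋖ Y)
| bi_lss_comma X Y Z : birule (Z ⊢ X ⨾ Y) (Z ⋖ Y ⊢ X)
| bi_comma_gtr X Y Z : birule (X ⨾ Y ⊢ Z) (Y ⊢ X ⋗ Z)
| bi_gtr_comma X Y Z : birule (Z ⊢ X ⨾ Y) (X ⋗ Z ⊢ Y)
| bi_dia_box c i (x : structure S (fst_typ i)) y z :
    birule (sdia c i x y ⊢ z) (y ⊢ sbox (opp c) i x z)
| bi_dia_lft c i (x : structure S (fst_typ i)) y z :
    birule (sdia c i x y ⊢ z) (x ⊢ slft (opp c) i z y).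

Inductive derivable (S : signature) : sequent S -> Prop :=
| two_way_down s s' : birule s s' -> derivable s -> derivable s'
| two_way_up s s' : birule s s' -> derivable s' -> derivable s
(* axioms *)
| ax_ag (a : term S Ag) : derivable (a ⊢ a)
| ax_fnc (α : term S Fnc) : derivable (α ⊢ α)
| ax_bot : derivable (Bot ⊢ sI)
| ax_top : derivable (sI ⊢ Top)
| ax_atom (p : prop_atom S) l m :
    derivable (pre (fun c => sdia c k0) l (Prp p)
               ⊢ pre (fun c => sbox c k0) m (Prp p))
| cut t (x : structure S t) (a : term S t) (y : structure S t) :
    derivable (x ⊢ a) -> derivable (a ⊢ y) -> derivable (x ⊢ y)
(* propositional structural rules *)
| I_weak_l X Y : derivable (sI ⊢ X) -> derivable (Y ⊢ X)
| I_weak_r X Y : derivable (X ⊢ sI) -> derivable (X ⊢ Y)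
| weak_lss_r X Y Z : derivable (X ⊢ Z) -> derivable (Y ⊢ Z ⋖ X)
| weak_lss_l X Y Z : derivable (X ⊢ Z) -> derivable (X ⋖ Z ⊢ Y)
| weak_gtr_r X Y Z : derivable (X ⊢ Z) -> derivable (Y ⊢ X ⋗ Z)
| weak_gtr_l X Y Z : derivable (X ⊢ Z) -> derivable (Z ⋗ X ⊢ Y)
| contr_l X Y : derivable (X ⨾ X ⊢ Y) -> derivable (X ⊢ Y)
| contr_r X Y : derivable (Y ⊢ X ⨾ X) -> derivable (Y ⊢ X)
| exch_l X Y Z : derivable (Y ⨾ X ⊢ Z) -> derivable (X ⨾ Y ⊢ Z)
| exch_r X Y Z : derivable (Z ⊢ X ⨾ Y) -> derivable (Z ⊢ Y ⨾ X)
| assoc_l X Y Z W :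
    derivable (X ⨾ (Y ⨾ Z) ⊢ W) -> derivable ((X ⨾ Y) ⨾ Z ⊢ W)
| assoc_r X Y Z W :
    derivable (W ⊢ (Z ⨾ Y) ⨾ X) -> derivable (W ⊢ Z ⨾ (Y ⨾ X))
(* propositional operational rules *)
| bot_r X : derivable (X ⊢ sI) -> derivable (X ⊢ Bot)
| top_l X : derivable (sI ⊢ X) -> derivable (Top ⊢ X)
| and_l (A B : term S Fm) Z : derivable (A ⨾ B ⊢ Z) -> derivable (And A B ⊢ Z)
| and_r X Y (A B : term S Fm) :
    derivable (X ⊢ A) -> derivable (Y ⊢ B) -> derivable (X ⨾ Y ⊢ And A B)
| or_l (A B : term S Fm) X Y :
    derivable (A ⊢ X) -> derivable (B ⊢ Y) -> derivable (Or A B ⊢ X ⨾ Y)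
| or_r (A B : term S Fm) Z : derivable (Z ⊢ A ⨾ B) -> derivable (Z ⊢ Or A B)
| limp_l (A B : term S Fm) X Y :
    derivable (B ⊢ Y) -> derivable (X ⊢ A) -> derivable (LImp B A ⊢ Y ⋖ X)
| limp_r (A B : term S Fm) Z :
    derivable (Z ⊢ B ⋖ A) -> derivable (Z ⊢ LImp B A)
| lcoimp_l (A B : term S Fm) Z :
    derivable (B ⋖ A ⊢ Z) -> derivable (LCoImp B A ⊢ Z)
| lcoimp_r (A B : term S Fm) X Y :
    derivable (Y ⊢ B) -> derivable (A ⊢ X) -> derivable (Y ⋖ X ⊢ LCoImp B A)
| imp_l (A B : term S Fm) X Y :
    derivable (X ⊢ A) -> derivable (B ⊢ Y) -> derivable (Imp A B ⊢ X ⋗ Y)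
| imp_r (A B : term S Fm) Z :
    derivable (Z ⊢ A ⋗ B) -> derivable (Z ⊢ Imp A B)
| coimp_l (A B : term S Fm) Z :
    derivable (A ⋗ B ⊢ Z) -> derivable (CoImp A B ⊢ Z)
| coimp_r (A B : term S Fm) X Y :
    derivable (A ⊢ X) -> derivable (Y ⊢ B) -> derivable (X ⋗ Y ⊢ CoImp A B)
(* heterogeneous operational rules *)
| dia_l c i (a : term S (fst_typ i)) (b : term S (snd_typ i)) z :
    derivable (sdia c i a b ⊢ z) -> derivable (odia c i a b ⊢ z)
| dia_r c i x y (a : term S (fst_typ i)) (b : term S (snd_typ i)) :
    derivable (x ⊢ a) -> derivable (y ⊢ b) ->
    derivable (sdia c i x y ⊢ odia c i a b)
| box_l c (k : idx2) x Y (a : term S (fst_typ k)) (B : term S Fm) :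
    derivable (x ⊢ a) -> derivable (B ⊢ Y) ->
    derivable (obox c k a B ⊢ sbox c k x Y)
| box_r c (k : idx2) (a : term S (fst_typ k)) (B : term S Fm) Z :
    derivable (Z ⊢ sbox c k a B) -> derivable (Z ⊢ obox c k a B)
(* necessitation *)
| nec_dia c (k : idx2) (x : structure S (fst_typ k)) W :
    derivable (sI ⊢ W) -> derivable (sdia c k x sI ⊢ W)
| nec_box c (k : idx2) (x : structure S (fst_typ k)) W :
    derivable (W ⊢ sI) -> derivable (W ⊢ sbox c k x sI)
(* conjugation *)
| conj_dia c (k : idx2) (x : structure S (fst_typ k)) Y Z W :
    derivable (sdia c k x (sdia (opp c) k x Y ⨾ Z) ⊢ W) ->
    derivable (Y ⨾ sdia c k x Z ⊢ W)
| conj_box c (k : idx2) (x : structure S (fst_typ k)) Y Z W :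
    derivable (W ⊢ sbox c k x (sbox (opp c) k x Y ⨾ Z)) ->
    derivable (W ⊢ Y ⨾ sbox c k x Z)
(* Fischer Servi *)
| fs_dia c (k : idx2) (x : structure S (fst_typ k)) Y Z W :
    derivable (sbox c k x Y ⋗ sdia c k x Z ⊢ W) ->
    derivable (sdia c k x (Y ⋗ Z) ⊢ W)
| fs_box c (k : idx2) (x : structure S (fst_typ k)) Y Z W :
    derivable (W ⊢ sdia c k x Y ⋗ sbox c k x Z) ->
    derivable (W ⊢ sbox c k x (Y ⋗ Z))
(* monotonicity *)
| mon_dia c (k : idx2) (x : structure S (fst_typ k)) Y Z W :
    derivable (sdia c k x Y ⨾ sdia c k x Z ⊢ W) ->
    derivable (sdia c k x (Y ⨾ Z) ⊢ W)
| mon_box c (k : idx2) (x : structure S (fst_typ k)) Y Z W :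
    derivable (W ⊢ sbox c k x Y ⨾ sbox c k x Z) ->
    derivable (W ⊢ sbox c k x (Y ⨾ Z))
(* interaction rules *)
| swap_out_l (a : structure S Ag) (F : structure S Fnc) X Y :
    derivable (sdia black k1 (sdia black k3 a F) (sdia black k2 a X) ⊢ Y) ->
    derivable (sdia black k2 a (sdia black k0 F X) ⊢ Y)
| swap_out_r (a : structure S Ag) (F : structure S Fnc) X Y :
    derivable (X ⊢ sbox black k1 (sdia black k3 a F) (sbox black k2 a Y)) ->
    derivable (X ⊢ sbox black k2 a (sbox black k0 F Y))
| swap_in_l (a : structure S Ag) (F : structure S Fnc) X Y :
    derivable (sdia black k2 a (sdia black k0 F X) ⊢ Y) ->
    derivable (sdia black k1 (sdia black k3 a F)
                 (sdia black k2 a (sdia white k0 F sI ⨾ X)) ⊢ Y)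
| swap_in_r (a : structure S Ag) (F : structure S Fnc) X Y :
    derivable (X ⊢ sbox black k2 a (sbox black k0 F Y)) ->
    derivable (X ⊢ sbox black k1 (sdia black k3 a F)
                     (sbox black k2 a (sdia white k0 F sI ⋗ Y)))
| balance (F : structure S Fnc) X Y :
    derivable (X ⊢ Y) -> derivable (sdia white k0 F X ⊢ sbox white k0 F Y).

Definition interderivable (S : signature) (C D : term S Fm) : Prop :=
  derivable (C ⊢ D) /\ derivable (D ⊢ C).

Notation "C ⊣⊢ D" := (interderivable C%dc D%dc)
  (at level 70, no associativity) : type_scope.

(* Main.v *)
(* Write ◇ = α ▵[k0] _ and □ = α ▹[k0] _.  Balance gives ◇C ⊢ □C, conjugation
   gives ◇⊤ ∧ □C ⊢ ◇C, and Fischer Servi gives ◇⊤ → □C ⊢ □C.  Hence, whenever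
   ◇C ⊢ E and ◇⊤ ∧ E ⊢ □C, both reduction laws ◇C ⊣⊢ ◇⊤ ∧ E and
   □C ⊣⊢ ◇⊤ → E follow.  Almost every clause is an instance: E = C for atoms
   and ⊥, E = ◇A ∨ ◇B, E = ◇A → ◇B, and for the epistemic modalities the two
   hypotheses on E are, by adjunction, the swap-out and swap-in rules. *)

Require Import Defs.
From Stdlib Require Import List.
Import ListNotations.

Set Implicit Arguments.
Unset Strict Implicit.

Local Open Scope dc_scope.

(** * Display, identity and intuitionistic propositional reasoning *)

Lemma display (S : signature) (s s' : sequent S) :
  birule s s' -> (derivable s <-> derivable s').
Proof.
  intro H; split; [exact (two_way_down H) | exact (two_way_up H)].
Qed.

(** The display postulate puts the colour change on the box; here it sits on the diamond. Since
    [opp (opp c)] reduces only for a concrete colour, the proof goes by cases on [c]. *)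
Lemma opp_dia_box (S : signature) c (k : idx2)
    (x : structure S (fst_typ k)) Y Z :
  derivable (sdia (opp c) k x Y ⊢ Z) <-> derivable (Y ⊢ sbox c k x Z).
Proof.
  destruct c; apply display.
  - exact (bi_dia_box black (i := low k) x Y Z).
  - exact (bi_dia_box white (i := low k) x Y Z).
Qed.

Lemma identity (S : signature) t (b : term S t) : derivable (b ⊢ b).
Proof.
  induction b.
  (* With both prefixes empty the atom axiom is plain identity on [p]. *)
  - exact (ax_atom p nil nil).
  - apply ax_fnc.
  - apply ax_ag.
  - apply bot_r, ax_bot.
  - apply top_l, ax_top.
  - now apply and_l, and_r.
  - now apply or_r, or_l.
  - now apply imp_r, imp_l.
  - now apply limp_r, limp_l.
  - now apply coimp_l, coimp_r.
  - now apply lcoimp_l, lcoimp_r.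
  - now apply dia_l, dia_r.
  - now apply box_r, box_l.
Qed.

Lemma weaken_l (S : signature) (X Y Z : structure S Fm) :
  derivable (Y ⊢ Z) -> derivable (X ⨾ Y ⊢ Z).
Proof.
  intro H; apply (display (bi_comma_lss X Y Z)); now apply weak_lss_r.
Qed.

Lemma weaken_r (S : signature) (X Y Z : structure S Fm) :
  derivable (X ⊢ Z) -> derivable (X ⨾ Y ⊢ Z).
Proof. intro H; apply exch_l; now apply weaken_l. Qed.

Lemma top_intro (S : signature) (X : structure S Fm) : derivable (X ⊢ Top).
Proof. apply I_weak_l, ax_top. Qed.

Lemma bot_elim (S : signature) (X : structure S Fm) : derivable (Bot ⊢ X).
Proof. apply I_weak_r, ax_bot. Qed.

Lemma and_intro (S : signature) (X : structure S Fm) (A B : term S Fm) :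
  derivable (X ⊢ A) -> derivable (X ⊢ B) -> derivable (X ⊢ A ⋏ B).
Proof. intros HA HB; apply contr_l; now apply and_r. Qed.

Lemma and_elim_l (S : signature) (A B : term S Fm) : derivable (A ⋏ B ⊢ A).
Proof. apply and_l, weaken_r, identity. Qed.

Lemma and_elim_r (S : signature) (A B : term S Fm) : derivable (A ⋏ B ⊢ B).
Proof. apply and_l, weaken_l, identity. Qed.

Lemma or_elim (S : signature) (A B : term S Fm) (X : structure S Fm) :
  derivable (A ⊢ X) -> derivable (B ⊢ X) -> derivable (A ⋎ B ⊢ X).
Proof. intros HA HB; apply contr_r; now apply or_l. Qed.

Lemma or_intro_l (S : signature) (A B : term S Fm) : derivable (A ⊢ A ⋎ B).
Proof.
  apply or_r, (display (bi_gtr_comma A B A)).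
  apply weak_gtr_l, identity.
Qed.

Lemma or_intro_r (S : signature) (A B : term S Fm) : derivable (B ⊢ A ⋎ B).
Proof.
  apply or_r, (display (bi_lss_comma A B B)).
  apply weak_lss_l, identity.
Qed.

Lemma imp_intro (S : signature) (A B C : term S Fm) :
  derivable (A ⋏ C ⊢ B) -> derivable (C ⊢ A ⟶ B).
Proof.
  intro H; apply imp_r, (display (bi_comma_gtr A C B)).
  apply cut with (2 := H); apply and_r; apply identity.
Qed.

Lemma imp_elim (S : signature) (A B : term S Fm) :
  derivable (A ⋏ (A ⟶ B) ⊢ B).
Proof.
  apply and_l, (display (bi_comma_gtr A (A ⟶ B) B)).
  apply imp_l; apply identity.
Qed.

(** * Modal laws common to all diamonds and boxes of subscript 0, 1, 2 *)

Lemma dia_mono (S : signature) c (k : idx2) (x : term S (fst_typ k))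
    (A B : term S Fm) :
  derivable (A ⊢ B) -> derivable (odia c k x A ⊢ odia c k x B).
Proof.
  intro H; apply (@dia_l S c (low k)), (@dia_r S c (low k)).
  - apply identity.
  - exact H.
Qed.

Lemma box_mono (S : signature) c (k : idx2) (x : term S (fst_typ k))
    (A B : term S Fm) :
  derivable (A ⊢ B) -> derivable (obox c k x A ⊢ obox c k x B).
Proof. intro H; apply box_r, box_l; [apply identity | exact H]. Qed.

(** The display postulate lifted to operational diamonds: the left rule is made invertible by a cut
    with the right rule. *)
Lemma dia_adjunct (S : signature) c (k : idx2) (x : term S (fst_typ k))
    (A : term S Fm) Z :
  derivable (odia c k x A ⊢ Z) <-> derivable (A ⊢ sbox (opp c) k x Z).
Proof.
  split; intro H.
  - apply (display (bi_dia_box c (i := low k) x A Z)).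
    apply (@cut S Fm _ (odia c k x A)); [| exact H].
    apply (@dia_r S c (low k)); apply identity.
  - apply (@dia_l S c (low k)).
    now apply (display (bi_dia_box c (i := low k) x A Z)).
Qed.

Lemma box_adjunct (S : signature) c (k : idx2) (x : term S (fst_typ k))
    (A : term S Fm) Z :
  derivable (Z ⊢ obox c k x A) <-> derivable (sdia (opp c) k x Z ⊢ A).
Proof.
  split; intro H.
  - apply opp_dia_box.
    apply cut with (1 := H); apply box_l; apply identity.
  - now apply box_r, opp_dia_box.
Qed.

Lemma dia_bot (S : signature) c (k : idx2) (x : term S (fst_typ k)) :
  derivable (odia c k x Bot ⊢ Bot).
Proof. apply dia_adjunct, bot_elim. Qed.

Lemma box_top (S : signature) c (k : idx2) (x : term S (fst_typ k)) :
  derivable (Top ⊢ obox c k x Top).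
Proof. apply box_adjunct, top_intro. Qed.

Lemma dia_or (S : signature) c (k : idx2) (x : term S (fst_typ k))
    (A B : term S Fm) :
  odia c k x (A ⋎ B) ⊣⊢ odia c k x A ⋎ odia c k x B.
Proof.
  split.
  - apply dia_adjunct, or_elim; apply dia_adjunct;
      [apply or_intro_l | apply or_intro_r].
  - apply or_elim; apply dia_mono; [apply or_intro_l | apply or_intro_r].
Qed.

Lemma box_and (S : signature) c (k : idx2) (x : term S (fst_typ k))
    (A B : term S Fm) :
  obox c k x (A ⋏ B) ⊣⊢ obox c k x A ⋏ obox c k x B.
Proof.
  split.
  - apply and_intro; apply box_mono; [apply and_elim_l | apply and_elim_r].
  - apply box_adjunct, and_intro; apply box_adjunct;
      [apply and_elim_l | apply and_elim_r].
Qed.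

Lemma box_conjugation (S : signature) c (k : idx2) (x : term S (fst_typ k))
    (A B : term S Fm) :
  derivable (obox c k x A ⋏ odia c k x B ⊢ odia c k x (A ⋏ B)).
Proof.
  apply and_l.
  (* The diamond is displayed alone on the left, made structural, and put back, so that conjugation
     can pull the box inside it. *)
  apply (display (bi_comma_gtr _ _ _)), (@dia_l S c (low k)),
    (display (bi_comma_gtr _ _ _)).
  apply conj_dia, (@dia_r S c (low k)); [apply identity |].
  (* The left premise is the counit: the opposite-coloured diamond of [obox c k x A] entails [A]. *)
  apply (@and_r S); [apply box_adjunct |]; apply identity.
Qed.

Lemma fischer_servi (S : signature) c (k : idx2) (x : term S (fst_typ k))
    (A B : term S Fm) :
  derivable (odia c k x A ⟶ obox c k x B ⊢ obox c k x (A ⟶ B)).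
Proof.
  (* Moving the box to the left as a diamond exposes the implication to [imp_r]; moving it back
     produces the structural form that [fs_box] expects. *)
  apply box_adjunct, imp_r, opp_dia_box, fs_box, imp_l.
  - apply (@dia_r S c (low k)); apply identity.
  - apply box_l; apply identity.
Qed.

(** The interaction rules speak of the structural triangle of subscript 3, the translated axioms of
    the operational one. Displaying the first argument at type [Act] allows the exchange, by a cut
    in one direction and the left rule in the other. *)
Lemma odia_sdia_fst (S : signature) c (a : term S Ag) (α : term S Fnc)
    d (X : structure S Fm) Z :
  derivable (sdia d k1 (odia c k3 a α) X ⊢ Z) <->
  derivable (sdia d k1 (sdia c k3 a α) X ⊢ Z).
Proof.
  split; intro H; apply (display (bi_dia_lft d (i := k1) _ X Z)).
  - apply (@cut S Act _ (odia c k3 a α)).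
    + apply (@dia_r S c k3); apply identity.
    + now apply (display (bi_dia_lft d (i := k1) _ X Z)).
  - apply (@dia_l S c k3).
    now apply (display (bi_dia_lft d (i := k1) _ X Z)).
Qed.

(** * Reduction laws for a fixed functional action *)

Section FunctionalAction.

Variables (S : signature) (α : term S Fnc).

Notation "◇ A" := (α ▵[k0] A) (at level 35, right associativity) : dc_scope.
Notation "□ A" := (α ▹[k0] A) (at level 35, right associativity) : dc_scope.

Lemma dia_box (A : term S Fm) : derivable (◇ A ⊢ □ A).
Proof. apply (@dia_l S white k0), box_r, balance, identity. Qed.

Lemma dia_top (A : term S Fm) : derivable (◇ A ⊢ ◇ Top).
Proof. apply (@dia_mono S white k0), top_intro. Qed.

Lemma dia_of_box (A : term S Fm) : derivable (◇ Top ⋏ □ A ⊢ ◇ A).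
Proof.
  apply (@cut S Fm _ (□ A ⋏ ◇ Top)).
  - apply and_intro; [apply and_elim_r | apply and_elim_l].
  - apply (cut (@box_conjugation S white k0 α A Top)).
    apply (@dia_mono S white k0), and_elim_l.
Qed.

Lemma box_of_guarded (A E : term S Fm) :
  derivable (◇ Top ⋏ E ⊢ □ A) -> derivable (◇ Top ⟶ E ⊢ □ A).
Proof.
  intro H.
  apply (@cut S Fm _ (◇ Top ⟶ □ A)).
  - apply imp_intro.
    apply (@cut S Fm _ (◇ Top ⋏ E)); [| exact H].
    apply and_intro; [apply and_elim_l | apply imp_elim].
  (* Fischer Servi turns the guard into [□ (Top ⟶ A)], whose inner [Top] is then discharged. *)
  - apply (cut (@fischer_servi S white k0 α Top A)).
    apply (@box_mono S white k0).
    apply (@cut S Fm _ (Top ⋏ (Top ⟶ A))); [| apply imp_elim].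
    apply and_intro; [apply top_intro | apply identity].
Qed.

Lemma reduction (C E : term S Fm) :
  derivable (◇ C ⊢ E) -> derivable (◇ Top ⋏ E ⊢ □ C) ->
  (◇ C ⊣⊢ ◇ Top ⋏ E) /\ (□ C ⊣⊢ ◇ Top ⟶ E).
Proof.
  intros H1 H2; repeat split.
  - apply and_intro; [apply dia_top | exact H1].
  - apply (@cut S Fm _ (◇ Top ⋏ □ C)); [| apply dia_of_box].
    apply and_intro; [apply and_elim_l | exact H2].
  - apply imp_intro.
    exact (cut (dia_of_box C) H1).
  - now apply box_of_guarded.
Qed.

(** A one-element prefix on the left of the atom axiom gives [◇ Prp p ⊢ Prp p], and one on the right
    gives [Prp p ⊢ □ Prp p]. *)
Lemma reduction_atom (p : prop_atom S) :
  (◇ Prp p ⊣⊢ ◇ Top ⋏ Prp p) /\ (□ Prp p ⊣⊢ ◇ Top ⟶ Prp p).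
Proof.
  apply reduction.
  - apply (@dia_l S white k0), (ax_atom p [(white, emb α)] nil).
  - apply (cut (and_elim_r _ _)).
    apply box_r, (ax_atom p nil [(white, emb α)]).
Qed.

Lemma reduction_bot : □ Bot ⊣⊢ ◇ Top ⟶ Bot.
Proof.
  apply reduction.
  - apply (@dia_bot S white k0).
  - apply (cut (and_elim_r _ _)), bot_elim.
Qed.

Lemma dia_and (A B : term S Fm) : ◇ (A ⋏ B) ⊣⊢ ◇ A ⋏ ◇ B.
Proof.
  split.
  - apply and_intro; apply (@dia_mono S white k0);
      [apply and_elim_l | apply and_elim_r].
  (* Weakening one diamond to a box, by balance, makes conjugation applicable. *)
  - apply (@cut S Fm _ (□ A ⋏ ◇ B)).
    + apply and_intro; [| apply and_elim_r].
      apply (cut (and_elim_l _ _)), dia_box.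
    + apply (@box_conjugation S white k0).
Qed.

Lemma reduction_or (A B : term S Fm) : □ (A ⋎ B) ⊣⊢ ◇ Top ⟶ (◇ A ⋎ ◇ B).
Proof.
  apply reduction.
  - apply (@dia_or S white k0).
  - apply (cut (and_elim_r _ _)).
    apply (cut (proj2 (@dia_or S white k0 α A B))), dia_box.
Qed.

(** Forwards, conjugation brings the implication under the diamond, where modus ponens applies.
    Backwards, balance weakens [◇ B] to [□ B] and Fischer Servi concludes. *)
Lemma box_imp (A B : term S Fm) : □ (A ⟶ B) ⊣⊢ ◇ A ⟶ ◇ B.
Proof.
  split.
  - apply imp_intro.
    apply (@cut S Fm _ (□ (A ⟶ B) ⋏ ◇ A)).
    + apply and_intro; [apply and_elim_r | apply and_elim_l].
    + apply (cut (@box_conjugation S white k0 α _ _)).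
      apply (@dia_mono S white k0).
      apply (@cut S Fm _ (A ⋏ (A ⟶ B))); [| apply imp_elim].
      apply and_intro; [apply and_elim_r | apply and_elim_l].
  - apply (@cut S Fm _ (◇ A ⟶ □ B)); [| apply (@fischer_servi S white k0)].
    apply imp_intro, (cut (imp_elim _ _)), dia_box.
Qed.

Lemma reduction_imp (A B : term S Fm) :
  ◇ (A ⟶ B) ⊣⊢ ◇ Top ⋏ (◇ A ⟶ ◇ B).
Proof.
  apply reduction.
  - apply (cut (dia_box _)), box_imp.
  - apply (cut (and_elim_r _ _)), box_imp.
Qed.

(** The swap-in rules carry the precondition as the structure [sdia white k0 α sI]; displaying [Top]
    lets [top_l] replace it by [sI]. *)
Lemma guard_l (E : term S Fm) (Z : structure S Fm) :
  derivable (sdia white k0 α sI ⨾ E ⊢ Z) -> derivable (◇ Top ⋏ E ⊢ Z).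
Proof.
  intro H; apply and_l, (display (bi_comma_lss _ _ _)).
  apply (@dia_adjunct S white k0), top_l.
  now apply (display (bi_dia_box white (i := k0) _ _ _)),
    (display (bi_comma_lss _ _ _)).
Qed.

Lemma reduction_ag_dia (a : term S Ag) (A : term S Fm) :
  let E := a ▵[k2] ((a ▴[k3] α) ▵[k1] A) in
  (◇ (a ▵[k2] A) ⊣⊢ ◇ Top ⋏ E) /\ (□ (a ▵[k2] A) ⊣⊢ ◇ Top ⟶ E).
Proof.
  intro E; apply reduction.
  - apply (@dia_adjunct S white k0), (@dia_adjunct S white k2), swap_out_r.
    apply (display (bi_dia_box white (i := k1) _ _ _)), odia_sdia_fst,
      (display (bi_dia_box white (i := k1) _ _ _)).
    apply (@dia_adjunct S white k1), (@dia_adjunct S white k2), identity.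
  (* The goal is strengthened from [□] to [◇], which unfolds by adjunction into the nested black
     boxes of [swap_in_r]. *)
  - apply (fun H => cut H (dia_box _)), guard_l, (display (bi_comma_gtr _ _ _)).
    apply (@dia_adjunct S white k2), (@dia_l S white k1), odia_sdia_fst.
    apply (display (bi_dia_box white (i := k1) _ _ _)), swap_in_r.
    apply (@dia_adjunct S white k2), (@dia_adjunct S white k0), identity.
Qed.

Lemma reduction_ag_box (a : term S Ag) (A : term S Fm) :
  let E := a ▹[k2] ((a ▴[k3] α) ▹[k1] A) in
  (◇ (a ▹[k2] A) ⊣⊢ ◇ Top ⋏ E) /\ (□ (a ▹[k2] A) ⊣⊢ ◇ Top ⟶ E).
Proof.
  intro E; apply reduction.
  (* Dually to the diamond case, swap-in now serves this first hypothesis, so the guard it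
     introduces must be split off from [◇] beforehand. *)
  - apply (@cut S Fm _ (◇ Top ⋏ □ (a ▹[k2] A))).
    + apply and_intro; [apply dia_top | apply dia_box].
    + apply guard_l, (@box_adjunct S white k2), (@box_adjunct S white k1).
      apply odia_sdia_fst, swap_in_l.
      apply (@box_adjunct S white k2), (@box_adjunct S white k0), identity.
  - apply (cut (and_elim_r _ _)).
    apply (@box_adjunct S white k0), (@box_adjunct S white k2), swap_out_l.
    apply odia_sdia_fst.
    apply (@box_adjunct S white k1), (@box_adjunct S white k2), identity.
Qed.

End FunctionalAction.

Theorem mainTheorem3 (S : signature) (p : prop_atom S)
    (α : term S Fnc) (a : term S Ag) (A B : term S Fm) :
  (α ▵[k0] Prp p ⊣⊢ (α ▵[k0] Top) ⋏ Prp p) /\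
  (α ▹[k0] Prp p ⊣⊢ (α ▵[k0] Top) ⟶ Prp p) /\
  (α ▵[k0] Bot ⊣⊢ Bot) /\
  (α ▵[k0] Top ⊣⊢ α ▵[k0] Top) /\
  (α ▹[k0] Top ⊣⊢ Top) /\
  (α ▹[k0] Bot ⊣⊢ (α ▵[k0] Top) ⟶ Bot) /\
  (α ▹[k0] (A ⋏ B) ⊣⊢ (α ▹[k0] A) ⋏ (α ▹[k0] B)) /\
  (α ▵[k0] (A ⋏ B) ⊣⊢ (α ▵[k0] A) ⋏ (α ▵[k0] B)) /\
  (α ▵[k0] (A ⋎ B) ⊣⊢ (α ▵[k0] A) ⋎ (α ▵[k0] B)) /\
  (α ▹[k0] (A ⋎ B) ⊣⊢
     (α ▵[k0] Top) ⟶ ((α ▵[k0] A) ⋎ (α ▵[k0] B))) /\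
  (α ▵[k0] (A ⟶ B) ⊣⊢
     (α ▵[k0] Top) ⋏ ((α ▵[k0] A) ⟶ (α ▵[k0] B))) /\
  (α ▹[k0] (A ⟶ B) ⊣⊢ (α ▵[k0] A) ⟶ (α ▵[k0] B)) /\
  (α ▵[k0] (a ▵[k2] A) ⊣⊢
     (α ▵[k0] Top) ⋏ (a ▵[k2] ((a ▴[k3] α) ▵[k1] A))) /\
  (α ▹[k0] (a ▵[k2] A) ⊣⊢
     (α ▵[k0] Top) ⟶ (a ▵[k2] ((a ▴[k3] α) ▵[k1] A))) /\
  (α ▹[k0] (a ▹[k2] A) ⊣⊢
     (α ▵[k0] Top) ⟶ (a ▹[k2] ((a ▴[k3] α) ▹[k1] A))) /\
  (α ▵[k0] (a ▹[k2] A) ⊣⊢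
     (α ▵[k0] Top) ⋏ (a ▹[k2] ((a ▴[k3] α) ▹[k1] A))).
Proof.
  (* Each of these three lemmas supplies two clauses, one for [◇] and one for [□]. *)
  destruct (reduction_atom α p), (reduction_ag_dia α a A),
    (reduction_ag_box α a A).
  pose proof (conj (@dia_bot S white k0 α) (bot_elim (α ▵[k0] Bot))).
  pose proof (conj (identity (α ▵[k0] Top)) (identity (α ▵[k0] Top))).
  pose proof (conj (top_intro (α ▹[k0] Top)) (@box_top S white k0 α)).
  pose proof (reduction_bot α).
  pose proof (@box_and S white k0 α A B).
  pose proof (dia_and α A B).
  pose proof (@dia_or S white k0 α A B).
  pose proof (reduction_or α A B).
  pose proof (reduction_imp α A B).
  pose proof (box_imp α A B).
  now repeat match goal with |- _ /\ _ => split; [assumption |] end.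
Qed.
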